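(* Let $n\ge 1$ and let $G$ be a nonempty subset of $[0,1)^n$ that is open in the subspace topology of $[0,1)^n\subseteq\mathbb{R}^n$. Let $d_G$ be the open set martingale for $G$ (defined in the context). Then for every $\mathbf{x}\in G$ there is $r_0$ such that $d_G^{(r)}(\mathbf{x})=1/m(G)$ for all $r\ge r_0$, where $m$ denotes Lebesgue measure.
   Context: For $r\in\mathbb{N}$ and $\mathbf{u}=(u_1,\dots,u_n)\in\mathbb{Z}^n$, the $r$-dyadic cube at $\mathbf{u}$ is $Q_r(\mathbf{u})=[u_1 2^{-r},(u_1+1)2^{-r})\times\cdots\times[u_n2^{-r},(u_n+1)2^{-r})$. Let $\mathcal{Q}_r=\{Q_r(\mathbf{u}):\mathbf{u}\in\{0,\dots,2^r-1\}^n\}$ (a partition of $[0,1)^n$) and $\mathcal{Q}=\bigcup_r\mathcal{Q}_r$. A martingale is a function $d:\mathcal{Q}\to[0,\infty)$ with $d(Q_r(\mathbf{u}))=2^{-n}\sum_{\mathbf{a}\in\{0,1\}^n}d(Q_{r+1}(2\mathbf{u}+\mathbf{a}))$ for all $Q_r(\mathbf{u})\in\mathcal{Q}$. For $\mathbf{x}\in[0,1)^n$, $d^{(r)}(\mathbf{x})=d(Q_r(\mathbf{u}))$ where $Q_r(\mathbf{u})\in\mathcal{Q}_r$ is the cube containing $\mathbf{x}$. For a set $G\subseteq[0,1)^n$ with $m(G)>0$, the martingale $d_G$ is defined recursively by $d_G(Q_0(\mathbf{0}))=1$ and, for $r\ge0$, $\mathbf{u}\in\{0,\dots,2^r-1\}^n$,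 $\mathbf{a}\in\{0,1\}^n$: $d_G(Q_{r+1}(2\mathbf{u}+\mathbf{a}))=0$ if $d_G(Q_r(\mathbf{u}))=0$, and otherwise $d_G(Q_{r+1}(2\mathbf{u}+\mathbf{a}))=2^n d_G(Q_r(\mathbf{u}))\frac{m(G\cap Q_{r+1}(2\mathbf{u}+\mathbf{a}))}{m(G\cap Q_r(\mathbf{u}))}$. When $G$ is open (in $[0,1)^n$), $d_G$ is called the open set martingale for $G$. *)

(* Defs.v *)
From HB Require Import structures.
From mathcomp Require Import all_boot all_order all_algebra.
From mathcomp Require Import all_classical all_reals all_analysis.
Import Order.TTheory GRing.Theory Num.Theory.
Import numFieldNormedType.Exports.

Set Implicit Arguments.
Unset Strict Implicit.
Unset Printing Implicit Defensive.

Local Open Scope classical_set_scope.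
Local Open Scope ring_scope.

Section lebesgue_measure_rV.
Variable R : realType.

Let Rm := measurableTypeR R.

Definition cons_pair n (p : n.-tuple Rm * Rm) : n.+1.-tuple Rm :=
  [tuple of p.2 :: p.1].

Lemma measurable_cons_pair n : measurable_fun setT (@cons_pair n).
Proof. exact: measurable_cons. Qed.

(* The pushforward of [mu \x lebesgue_measure] along [cons_pair]; the library's
   canonical measure structure is named explicitly because inference cannot
   find the measurability argument. *)
Definition lebesgue_tupleS n (mu : {measure set (n.-tuple Rm) -> \bar R}) :
    {measure set (n.+1.-tuple Rm) -> \bar R} :=
  measure_function_pushforward__canonical__measure_function_Measure
    (mu \x @lebesgue_measure R)%E (@measurable_cons_pair n).

(* Lebesgue measure on R^n as the n-fold product of the one on the line. *)
Fixpoint lebesgue_tuple n : {measure set (n.-tuple Rm) -> \bar R} :=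
  if n is n'.+1 then lebesgue_tupleS (lebesgue_tuple n')
  else \d_([tuple] : 0.-tuple Rm).

(* The same measure on row vectors, which carry the topology of R^n. *)
Definition lebesgue_rV n (A : set 'rV[R]_n) : \bar R :=
  lebesgue_tuple n [set t : n.-tuple Rm | A (\row_i tnth t i)].

Lemma lebesgue_tuple_box n (a b : 'I_n -> R) : (forall i, a i <= b i) ->
  lebesgue_tuple n [set t | forall i, tnth t i \in `[a i, b i[] =
  (\prod_i (b i - a i))%:E.
Proof.
elim: n a b => [|n IHn] a b ab /=.
  by rewrite big_ord0 diracE mem_set// => -[].
rewrite /lebesgue_tupleS/= /pushforward.
have -> : @cons_pair n @^-1` [set t | forall i, tnth t i \in `[a i, b i[] =
    [set t | forall i, tnth t i \in `[a (lift ord0 i), b (lift ord0 i)[]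
    `*` [set` `[a ord0, b ord0[].
  apply/seteqP; split=> -[t x] /= => [tab|[tab xab] i].
    split=> [i|]; last exact: (tab ord0).
    by have := tab (lift ord0 i); rewrite /cons_pair tnthS.
  case: (unliftP ord0 i) => [j|] ->; last exact: xab.
  by rewrite /cons_pair tnthS; exact: tab.
rewrite product_measure1E//=; last first.
  rewrite (_ : [set t | _] = \big[setI/setT]_(i < n)
      (fun t : n.-tuple Rm => tnth t i) @^-1`
        [set` `[a (lift ord0 i), b (lift ord0 i)[]).
    apply: bigsetI_measurable => i _; rewrite -[X in measurable X]setTI.
    by apply: measurable_tnth.
  rewrite -bigcap_seq.
  apply/seteqP; split=> t /= tab i; first by move=> _; exact: tab.
  by apply: tab; rewrite /= mem_index_enum.
rewrite IHn// lebesgue_measure_itv/= lte_fin big_ord_recl mulrC.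
have [_|ba] := ltP; first by rewrite -EFinD -EFinM.
by have -> : a ord0 = b ord0; [exact/le_anti/andP|rewrite subrr mulr0 mule0].
Qed.

Lemma lebesgue_rV_box n (a b : 'rV[R]_n) : (forall i, a 0 i <= b 0 i) ->
  lebesgue_rV [set x | forall i, a 0 i <= x 0 i < b 0 i] =
  (\prod_i (b 0 i - a 0 i))%:E.
Proof.
move=> ab; rewrite -(lebesgue_tuple_box ab) /lebesgue_rV.
congr (lebesgue_tuple _ _).
by apply/seteqP; split=> t /= tab i; move: (tab i); rewrite mxE in_itv.
Qed.

End lebesgue_measure_rV.

Section dyadic_martingale.
Variables (R : realType) (n : nat).
Implicit Types (u v : 'rV[int]_n) (x : 'rV[R]_n) (G : set 'rV[R]_n).

(* Real-valued; [fine] maps the value +oo to 0, but here only subsets of the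
   unit cube are measured. *)
Definition volume G : R := fine (lebesgue_rV G).

Definition unit_cube : set 'rV[R]_n := [set x | forall i, 0 <= x 0 i < 1].

Definition dyadic_cube (r : nat) u : set 'rV[R]_n :=
  [set x | forall i,
    (u 0 i)%:~R * 2 ^- r <= x 0 i < (u 0 i + 1)%:~R * 2 ^- r].

Definition dyadic_index (r : nat) : set 'rV[int]_n :=
  [set u | forall i, 0 <= u 0 i < 2 ^+ r].

(* A function [d] on the dyadic cubes of the unit cube is represented by the
   function sending [r] and [u], with [u] in [dyadic_index r], to the value of
   [d] at [dyadic_cube r u]; for n >= 1 distinct pairs give distinct cubes.
   Values at other [u] are irrelevant. [martingale_at d r x] is the value of
   [d] at the cube of level [r] that contains [x]. *)
Definition martingale_at (d : nat -> 'rV[int]_n -> R) (r : nat) x : R :=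
  d r (xget 0 [set u | dyadic_index r u /\ dyadic_cube r u x]).

(* The [u] such that v = 2 u + a with all entries of [a] in {0, 1}: the cube
   of level [r] at [dyadic_parent v] contains that of level [r.+1] at [v]. *)
Definition dyadic_parent v : 'rV[int]_n := \row_i (v 0%R i %/ 2)%Z.

Fixpoint set_martingale G (r : nat) : 'rV[int]_n -> R :=
  if r is r'.+1 then fun v =>
    let u := dyadic_parent v in
    if set_martingale G r' u == 0 then 0
    else 2 ^+ n * set_martingale G r' u *
         (volume (G `&` dyadic_cube r'.+1 v) / volume (G `&` dyadic_cube r' u))
  else fun=> 1.

Lemma dyadic_parent_double u (a : 'I_n -> bool) :
  dyadic_parent (u *+ 2 + \row_i (a i : nat)%:Z) = u.
Proof.
apply/rowP => i; rewrite mulr2n !mxE -mulr2n -(mulr_natr (u 0 i)) divzMDl//.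
by case: (a i); rewrite addr0.
Qed.

Lemma set_martingale_rec G r u (a : 'I_n -> bool) :
  let v := u *+ 2 + \row_i (a i : nat)%:Z in
  set_martingale G r.+1 v =
  if set_martingale G r u == 0 then 0
  else 2 ^+ n * set_martingale G r u *
       (volume (G `&` dyadic_cube r.+1 v) / volume (G `&` dyadic_cube r u)).
Proof. by rewrite /= dyadic_parent_double. Qed.

End dyadic_martingale.

Arguments unit_cube : clear implicits.

(* Main.v *)
Require Import Defs.
From mathcomp Require Import all_boot all_order all_algebra.
From mathcomp Require Import all_classical all_reals all_analysis.
Import Order.TTheory GRing.Theory Num.Theory.
Import numFieldNormedType.Exports.
Local Open Scope classical_set_scope.
Local Open Scope ring_scope.

(* Along the dyadic cubes Q_r containing a point x of G, the recursion
   telescopes to d_G(Q_r) = 2^(nr) m(G `&` Q_r) / m(G); it never falls into the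
   zero branch because G `&` Q_r contains a smaller dyadic cube around x.  Once
   Q_r lies in G, m(G `&` Q_r) = 2^(-nr) and the value is 1 / m(G). *)

(* Unlike in [ge0_le_integral], nothing is measurable here: the integral of a
   nonnegative function is a supremum over the simple functions below it. This
   makes [lebesgue_rV] monotone on arbitrary sets, so that G is never shown to
   be measurable. *)
Lemma le_integral_pointwise {d} {T : measurableType d} {R : realType}
    (mu : {measure set T -> \bar R}) (f g : T -> \bar R) :
  (forall x, 0 <= f x)%E -> (forall x, f x <= g x)%E ->
  (\int[mu]_x f x <= \int[mu]_x g x)%E.
Proof.
move=> f0 fg.
have g0 x : (0 <= g x)%E by exact: le_trans (f0 x) (fg x).
rewrite !ge0_integralTE//; apply: le_ereal_sup => _ [h /= hf <-].
by exists h => // x; exact: le_trans (hf x) (fg x).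
Qed.

(** As a function on all sets, [lebesgue_measure] is an outer measure. *)
Lemma le_lebesgue_measure {R : realType} {A B : set R} : A `<=` B ->
  (lebesgue_measure A <= lebesgue_measure B)%E.
Proof. by move=> AB; apply: le_outer_measure. Qed.

(** A case split replaces induction: in dimension n+1 the measure integrates the one-dimensional
    measure of the sections, which grow with the set. *)
Lemma le_lebesgue_tuple {R : realType} {n}
    {A B : set (n.-tuple (measurableTypeR R))} :
  A `<=` B -> (lebesgue_tuple R n A <= lebesgue_tuple R n B)%E.
Proof.
case: n A B => [|n] A B AB /=.
  rewrite !diracE lee_fin ler_nat.
  by have [/set_mem/AB/mem_set -> //|] := boolP (_ \in A).
rewrite /lebesgue_tupleS/= /pushforward /product_measure1.
apply: (le_integral_pointwise (lebesgue_tuple R n)) => // t.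
by apply/le_lebesgue_measure/le_xsection => p; exact: AB.
Qed.

Lemma le_lebesgue_rV {R : realType} {n} {A B : set 'rV[R]_n} :
  A `<=` B -> (lebesgue_rV A <= lebesgue_rV B)%E.
Proof. by move=> AB; apply: le_lebesgue_tuple => t; exact: AB. Qed.

Lemma lebesgue_rV_unit_cube (R : realType) n :
  lebesgue_rV (unit_cube R n) = 1%E.
Proof.
have := @lebesgue_rV_box R n 0 (const_mx 1).
under eq_bigr do rewrite !mxE subr0.
rewrite big1// => <- => [|i]; last by rewrite !mxE.
by congr lebesgue_rV; apply/seteqP; split=> x /= xP i; move: (xP i); rewrite !mxE.
Qed.

Lemma le_volume {R : realType} {n} {A B : set 'rV[R]_n} :
  A `<=` B -> B `<=` unit_cube R n -> volume A <= volume B.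
Proof.
move=> AB B1.
(* [fine] is monotone on finite values only, since it sends +oo to 0. *)
have fin C : C `<=` unit_cube R n -> lebesgue_rV C \is a fin_num.
  move=> C1; rewrite ge0_fin_numE ?measure_ge0//.
  by rewrite (le_lt_trans (le_lebesgue_rV C1))// lebesgue_rV_unit_cube ltry.
by rewrite fine_le ?fin ?le_lebesgue_rV//; exact: subset_trans AB B1.
Qed.

Lemma volume_dyadic_cube {R : realType} {n r} {u : 'rV[int]_n} :
  volume (dyadic_cube r u : set 'rV[R]_n) = 2 ^- r ^+ n.
Proof.
have := @lebesgue_rV_box R n (\row_i ((u 0 i)%:~R * 2 ^- r))
  (\row_i ((u 0 i + 1)%:~R * 2 ^- r)).
under eq_bigr do rewrite !mxE -mulrBl -intrB addrAC subrr add0r mul1r.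
rewrite prodr_const card_ord => box; rewrite /volume.
rewrite (_ : dyadic_cube r u = [set x : 'rV[R]_n | forall i,
  (\row_i ((u 0 i)%:~R * 2 ^- r)) 0 i <= x 0 i <
  (\row_i ((u 0 i + 1)%:~R * 2 ^- r)) 0 i]).
  rewrite box// => i; rewrite !mxE ler_wpM2r ?invr_ge0 ?exprn_ge0//.
  by rewrite ler_int lerDl.
by apply/seteqP; split=> x /= xP i; move: (xP i); rewrite !mxE.
Qed.

(** Puts coarse endpoints on the finer grid, where comparing endpoints is comparing integers. *)
Lemma dyadic_rescale {R : realType} r k (m : int) :
  m%:~R * 2 ^- r = (m * 2 ^+ k)%:~R * 2 ^- (r + k) :> R.
Proof.
by rewrite exprD intrM rmorphXn/= -mulf_div divff ?mulr1// expf_neq0.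
Qed.

Lemma dyadic_itv_nested {R : realType} {r k} {u v : int} {x y : R} :
  u%:~R * 2 ^- r <= x < (u + 1)%:~R * 2 ^- r ->
  v%:~R * 2 ^- (r + k) <= x < (v + 1)%:~R * 2 ^- (r + k) ->
  v%:~R * 2 ^- (r + k) <= y < (v + 1)%:~R * 2 ^- (r + k) ->
  u%:~R * 2 ^- r <= y < (u + 1)%:~R * 2 ^- r.
Proof.
have p2 : 0 < 2 ^- (r + k) :> R by rewrite invr_gt0 exprn_gt0.
rewrite !(dyadic_rescale r k) => /andP[ux xu] /andP[vx xv] /andP[vy yv].
(* The common point x gives u 2^k < v + 1, hence u 2^k <= v as these are integers; likewise v < (u +
   1) 2^k gives v + 1 <= (u + 1) 2^k. *)
apply/andP; split.
  apply: le_trans vy; rewrite ler_pM2r// ler_int -ltzD1.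
  by rewrite -(ltr_int R) -(ltr_pM2r p2); exact: le_lt_trans ux xv.
apply: (lt_le_trans yv); rewrite ler_pM2r// ler_int lezD1.
by rewrite -(ltr_int R) -(ltr_pM2r p2); exact: le_lt_trans vx xu.
Qed.

Lemma dyadic_cube_nested {R : realType} {n r s} {u v : 'rV[int]_n}
    {x : 'rV[R]_n} : (r <= s)%N -> dyadic_cube r u x ->
  dyadic_cube s v x -> dyadic_cube s v `<=` (dyadic_cube r u : set 'rV[R]_n).
Proof.
move=> /subnKC <- xu xv y yv i.
exact: dyadic_itv_nested (xu i) (xv i) (yv i).
Qed.

Lemma dyadic_cube_parent {R : realType} {n r} {v : 'rV[int]_n} :
  (dyadic_cube r.+1 v : set 'rV[R]_n) `<=` dyadic_cube r (dyadic_parent v).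
Proof.
move=> x xv i; move: (xv i); rewrite mxE => /andP[vx xv1].
have p2 : 0 < 2 ^- r.+1 :> R by rewrite invr_gt0 exprn_gt0.
(* With q the quotient of an entry v by 2, it remains that 2 q <= v and v + 1 <= 2 (q + 1). *)
rewrite !(dyadic_rescale r 1) addn1; apply/andP; split.
  apply: le_trans vx; rewrite ler_pM2r// ler_int.
  exact: lez_floor.
apply: (lt_le_trans xv1); rewrite ler_pM2r// ler_int lezD1.
exact: ltz_ceil.
Qed.

Lemma dyadic_index_parent {n r} {v : 'rV[int]_n} :
  dyadic_index r.+1 v -> dyadic_index r (dyadic_parent v).
Proof.
move=> vr i; move: (vr i); rewrite mxE => /andP[v0 vlt].
by rewrite divz_ge0// v0/= ltz_divLR// mulrC -exprS.
Qed.

Lemma dyadic_cube_sub_unit_cube {R : realType} {n r} {u : 'rV[int]_n} :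
  dyadic_index r u -> (dyadic_cube r u : set 'rV[R]_n) `<=` unit_cube R n.
Proof.
move=> ur x xu i; have /andP[u0 ult] := ur i; have /andP[ux xu1] := xu i.
have p2 : 0 < 2 ^- r :> R by rewrite invr_gt0 exprn_gt0.
apply/andP; split; first by apply: le_trans ux; rewrite mulr_ge0 ?ler0z// ltW.
apply: (lt_le_trans xu1); rewrite ler_pdivrMr ?exprn_gt0// mul1r.
by move: ult; rewrite -lezD1 -(ler_int R) rmorphXn.
Qed.

Lemma dyadic_cube_exists {R : realType} {n} r {x : 'rV[R]_n} :
  unit_cube R n x -> exists u, dyadic_index r u /\ dyadic_cube r u x.
Proof.
have p2 : 0 < 2 ^+ r :> R by rewrite exprn_gt0.
move=> x1; exists (\row_i Num.floor (x 0 i * 2 ^+ r)); split=> i; rewrite mxE.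
  have /andP[x0 xlt] := x1 i; rewrite floor_ge0 mulr_ge0 ?(ltW p2)//=.
  by rewrite floor_lt_int rmorphXn/= gtr_pMl.
by rewrite ler_pdivrMr// ltr_pdivlMr// floor_itv.
Qed.

(** Two points of a cube of level r differ by less than 2^-r in each coordinate, so the cube lies in
    any sup-norm ball around x of radius above 2^-r. *)
Lemma dyadic_cube_sub_open {R : realType} {n} {G : set 'rV[R]_n} {x} :
  open (G : set (subspace (unit_cube R n))) -> G x -> unit_cube R n x ->
  exists r0 : nat, forall r u, (r0 <= r)%N ->
    dyadic_index r u -> dyadic_cube r u x -> dyadic_cube r u `<=` G.
Proof.
move=> /open_subspaceP[V oV VG] Gx x1.
have : (V `&` unit_cube R n) x by rewrite VG.
move=> -[Vx _]; have /nbhs_ballP[e /= e0 eV] := open_nbhs_nbhs (conj oV Vx).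
have [r0 r0e] : exists r0 : nat, 2 ^- r0 < e.
  (* 2^k exceeds 1/e for every k from [Num.bound e^-1] on. *)
  exists (Num.bound e^-1); rewrite invf_plt ?posrE ?exprn_gt0//.
  exact: upper_nthrootP.
exists r0 => r u r0r ur xu y yu.
suff : (V `&` unit_cube R n) y by rewrite VG => -[].
split; last exact: dyadic_cube_sub_unit_cube yu.
apply: eV; split=> // i j; rewrite ord1; apply: lt_trans r0e.
have /andP[ux xu1] := xu j; have /andP[uy yu1] := yu j.
suff : `|x 0 j - y 0 j| < 2 ^- r.
  move=> /lt_le_trans; apply; rewrite lef_pV2 ?posrE ?exprn_gt0//.
  by rewrite ler_eXn2l// ltr1n.
have {}xu1 : x 0 j < (u 0 j)%:~R * 2 ^- r + 2 ^- r.
  by rewrite -[X in _ + X]mul1r -mulrDl -[1]/(1%:~R) -intrD.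
have {}yu1 : y 0 j < (u 0 j)%:~R * 2 ^- r + 2 ^- r.
  by rewrite -[X in _ + X]mul1r -mulrDl -[1]/(1%:~R) -intrD.
by rewrite ltr_distl ltrBlDr (lt_le_trans yu1) ?(lt_le_trans xu1) ?lerD2r.
Qed.

Lemma volume_setI_dyadic_cube_gt0 {R : realType} {n}
    {G : set 'rV[R]_n} {r u x} :
  G `<=` unit_cube R n -> open (G : set (subspace (unit_cube R n))) ->
  G x -> dyadic_cube r u x -> 0 < volume (G `&` dyadic_cube r u).
Proof.
move=> G1 oG Gx xu; have [r0 r0P] := dyadic_cube_sub_open oG Gx (G1 _ Gx).
(* Level at least r0 puts the cube inside G; level at least r puts it inside the given cube. *)
have [v [vi xv]] := dyadic_cube_exists (maxn r0 r) (G1 _ Gx).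
apply: (@lt_le_trans _ _ (volume (dyadic_cube (maxn r0 r) v : set 'rV[R]_n))).
  by rewrite volume_dyadic_cube exprn_gt0// invr_gt0 exprn_gt0.
apply: le_volume; last by move=> y [/G1].
rewrite subsetI; split; first exact: r0P (leq_maxl _ _) vi xv.
exact: dyadic_cube_nested (leq_maxr _ _) xu xv.
Qed.

Lemma set_martingale_dyadic_cube {R : realType} {n}
    {G : set 'rV[R]_n} {r u x} :
  G `<=` unit_cube R n -> open (G : set (subspace (unit_cube R n))) ->
  G x -> dyadic_index r u -> dyadic_cube r u x ->
  set_martingale G r u =
  (2 ^+ r) ^+ n * volume (G `&` dyadic_cube r u) / volume G.
Proof.
move=> G1 oG Gx.
have Gpos s v xv := volume_setI_dyadic_cube_gt0 (r := s) (u := v) G1 oG Gx xv.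
(* The only index of level 0 is the zero vector, and its cube is the whole unit cube. *)
have G0 v : dyadic_index 0 v -> G `&` dyadic_cube 0 v = G.
  move=> v0; apply/setIidPl => y /G1 y1 i; have := v0 i; have := y1 i.
  rewrite expr0 invr1 !mulr1.
  by case: (v 0 i) => [[|//]|//]; rewrite add0r.
have Gn0 : volume G != 0.
  have [v [vi xv]] := dyadic_cube_exists 0 (G1 _ Gx).
  by rewrite -(G0 _ vi) gt_eqF ?Gpos.
elim: r u => [|r IHr] v vi xv /=; first by rewrite G0// expr0 expr1n mul1r divff.
have xu := dyadic_cube_parent _ xv.
have up := Gpos _ _ xu.
rewrite IHr//; last exact: dyadic_index_parent.
(* The parent's value is a product of nonzero factors, which excludes the zero branch. *)
rewrite !mulf_eq0 invr_eq0 (negPf Gn0) !expf_eq0/= (gt_eqF up).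
rewrite pnatr_eq0 !andbF/= exprS exprMn.
rewrite -!mulrA; congr (_ * (_ * _)).
(* The volume of G in the parent cube cancels. *)
by rewrite mulrCA [X in _ * X]mulrCA mulfV ?gt_eqF// mulr1 mulrC.
Qed.

Theorem theorem1 (R : realType) (n : nat) (G : set 'rV[R]_n) :
  (1 <= n)%N ->
  G !=set0 ->
  G `<=` unit_cube R n ->
  open (G : set (subspace (unit_cube R n))) ->
  forall x : 'rV[R]_n, G x ->
  exists r0 : nat, forall r : nat, (r0 <= r)%N ->
    martingale_at (set_martingale G) r x = 1 / volume G.
Proof.
move=> _ _ G1 oG x Gx.
have [r0 r0P] := dyadic_cube_sub_open oG Gx (G1 _ Gx).
exists r0 => r r0r; rewrite /martingale_at.
(* The default index of [xget] never arises, as x lies in some cube of level r. *)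
case: xgetP => [u _ [ui xu]|noindex]; last first.
  by have [u /noindex] := dyadic_cube_exists r (G1 _ Gx).
rewrite (set_martingale_dyadic_cube G1 oG Gx ui xu).
rewrite (setIidr (r0P _ _ r0r ui xu)) volume_dyadic_cube.
by rewrite -exprMn mulfV ?expr1n// expf_neq0.
Qed.
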